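(* Let $H:\mathbb{R}^n\times\mathbb{R}^n\to\mathbb{R}$ be continuous and assume: (1) there is $C_1>0$ with $H(x,p)\ge -C_1$ for all $(x,p)\in\mathbb{R}^n\times\mathbb{R}^n$; (2) there is $C_2>0$ with $\sup_{x\in\mathbb{R}^n}|H(x,0)|\le C_2$; (3) for each $R>0$ there is a constant $C_R$ such that $|H(x,p)-H(y,p)|\le C_R|x-y|$ and $|H(x,p)-H(x,q)|\le C_R|p-q|$ for all $x,y\in\mathbb{R}^n$ and all $p,q\in\mathbb{R}^n$ with $|p|,|q|\le R$; (4) $\lim_{|p|\to\infty}\big(\inf_{x\in\mathbb{R}^n}H(x,p)\big)=+\infty$. For $k\in\mathbb{N}$ let $u_k$ be the unique state-constraint viscosity solution of $u_k(x)+H(x,Du_k(x))=0$ in $B(0,k)$, and let $u$ be the unique state-constraint viscosity solution of $u(x)+H(x,Du(x))=0$ in $\mathbb{R}^n$. Then: (i) $u(x)\le u_k(x)$ for every $k\in\mathbb{N}$ and every $x\in\overline{B(0,k)}$; (ii) there exists a constant $C>0$ depending only on $H$ such that $$0\le u_k(x)-u(x)\le \frac{C(1+|x|^2)}{k^2}\qquad\text{for all }k\in\mathbb{N}\text{ and }x\in\overline{B(0,k)}.$$ In particular, for any fixed $R>0$, all $k\in\mathbb{N}$ and all $x\in\overline{B(0,k)}$ with $|x|\le R$, one has $0\le u_k(x)-u(x)\le \frac{C(1+R^2)}{k^2}$.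
   Context: $\mathbb{N}=\{1,2,\dots\}$; $B(0,k)$ is the open ball of radius $k$ in $\mathbb{R}^n$. BUC denotes bounded uniformly continuous functions. For an open set $\Omega\subset\mathbb{R}^n$ and a continuous $H$: $v\in \mathrm{BUC}(\Omega;\mathbb{R})$ is a viscosity subsolution of $v+H(x,Dv)=0$ in $\Omega$ if for every $x\in\Omega$ and $\varphi\in C^1(\Omega)$ such that $v-\varphi$ has a local maximum over $\Omega$ at $x$, $v(x)+H(x,D\varphi(x))\le 0$. $v\in \mathrm{BUC}(\overline\Omega;\mathbb{R})$ is a viscosity supersolution on $\overline\Omega$ if for every $x\in\overline\Omega$ and $\varphi\in C^1(\overline\Omega)$ (i.e. $C^1$ on a neighborhood of $\overline\Omega$) such that $v-\varphi$ has a local minimum over $\overline\Omega$ at $x$, $v(x)+H(x,D\varphi(x))\ge 0$. A state-constraint viscosity solution in $\Omega$ is a function that is both a viscosity subsolution in $\Omega$ and a viscosity supersolution on $\overline\Omega$. For $\Omega=\mathbb{R}^n$ this is the usual notion of viscosity solution in $\mathrm{BUC}(\mathbb{R}^n)$. Under the hypotheses of the claim, such solutions exist and are unique. *)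

(* Defs.v *)
From mathcomp Require Import all_boot all_order all_algebra.
From mathcomp Require Import all_classical all_reals all_analysis.
Import Order.TTheory GRing.Theory Num.Theory.
Import numFieldNormedType.Exports.

Set Implicit Arguments.
Unset Strict Implicit.
Unset Printing Implicit Defensive.

Local Open Scope classical_set_scope.
Local Open Scope ring_scope.

(* The norm that MathComp-Analysis puts on 'rV[R]_n is the sup norm; its
   topology and uniformity are the usual ones, but balls and growth conditions
   below refer to the Euclidean norm. *)
Definition enorm (R : realType) (n : nat) (x : 'rV[R]_n) : R :=
  Num.sqrt (\sum_(i < n) x 0 i ^+ 2).

Definition eball (R : realType) (n : nat) (r : R) : set 'rV[R]_n :=
  [set x | enorm x < r].

Definition grad (R : realType) (n : nat) (phi : 'rV[R]_n -> R) (x : 'rV[R]_n) :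
    'rV[R]_n :=
  \row_(i < n) 'D_('e_i) phi x.

Definition C1_open (R : realType) (n : nat) (U : set 'rV[R]_n)
    (phi : 'rV[R]_n -> R) : Prop :=
  forall x, U x -> differentiable phi x /\ {for x, continuous (grad phi)}.

Definition C1_closed (R : realType) (n : nat) (A : set 'rV[R]_n)
    (phi : 'rV[R]_n -> R) : Prop :=
  exists U : set 'rV[R]_n, [/\ open U, A `<=` U & C1_open U phi].

(* Functions on a subset A of R^n are represented by total functions; only
   their values on A matter. *)
Definition BUC (R : realType) (n : nat) (A : set 'rV[R]_n)
    (v : 'rV[R]_n -> R) : Prop :=
  [bounded v x | x in A] /\ unif_continuous (v : subspace A -> R).

Definition loc_max_on (R : realType) (n : nat) (A : set 'rV[R]_n)
    (f : 'rV[R]_n -> R) (x : 'rV[R]_n) : Prop :=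
  \forall y \near x, A y -> f y <= f x.

Definition loc_min_on (R : realType) (n : nat) (A : set 'rV[R]_n)
    (f : 'rV[R]_n -> R) (x : 'rV[R]_n) : Prop :=
  \forall y \near x, A y -> f x <= f y.

Definition viscosity_subsolution (R : realType) (n : nat)
    (H : 'rV[R]_n -> 'rV[R]_n -> R) (Omega : set 'rV[R]_n)
    (v : 'rV[R]_n -> R) : Prop :=
  BUC Omega v /\
  forall x (phi : 'rV[R]_n -> R), Omega x -> C1_open Omega phi ->
    loc_max_on Omega (v \- phi) x -> v x + H x (grad phi x) <= 0.

Definition viscosity_supersolution_closure (R : realType) (n : nat)
    (H : 'rV[R]_n -> 'rV[R]_n -> R) (Omega : set 'rV[R]_n)
    (v : 'rV[R]_n -> R) : Prop :=
  BUC (closure Omega) v /\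
  forall x (phi : 'rV[R]_n -> R), closure Omega x ->
    C1_closed (closure Omega) phi ->
    loc_min_on (closure Omega) (v \- phi) x -> 0 <= v x + H x (grad phi x).

Definition state_constraint_solution (R : realType) (n : nat)
    (H : 'rV[R]_n -> 'rV[R]_n -> R) (Omega : set 'rV[R]_n)
    (v : 'rV[R]_n -> R) : Prop :=
  viscosity_subsolution H Omega v /\ viscosity_supersolution_closure H Omega v.

(* Main.v *)
(* Doubling of variables with an extra quadratic penalization: maximize
     w x - v y - a |x|^2 - c |x - y|^2
   over a product of two compact sets, with w a subsolution and v a
   supersolution. Coercivity of H, applied to the subsolution inequality at
   the maximum point, bounds the momentum uniformly, so the local Lipschitz
   bound on H applies and no a priori gradient estimate is needed. Letting c
   tend to infinity, the maximum is at most 2 a L |x| - a |x|^2 <= a L^2.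
   For (i) take w = u, v = u_k and a = 0: the subsolution u lives on the whole
   space, so x may range over a larger ball and its optimum is interior; only
   y meets the boundary, where the state constraint gives the inequality.
   For (ii) take w = u_k, v = u and a = M / k^2 with M a bound on u_k - u: the
   penalization a |x|^2 reaches M on the sphere, so a positive maximum is
   attained inside the ball. *)
Require Import Defs.
From mathcomp Require Import all_boot all_order all_algebra.
From mathcomp Require Import all_classical all_reals all_analysis.
From mathcomp Require Import ring lra.
Import Order.TTheory GRing.Theory Num.Theory.
Import numFieldNormedType.Exports.
Local Open Scope classical_set_scope.
Local Open Scope ring_scope.

(** * Algebra of the Euclidean norm *)

Lemma enorm_sqr {R : realType} {n : nat} (x : 'rV[R]_n) :
  enorm x ^+ 2 = \sum_(i < n) x 0 i ^+ 2.
Proof. by rewrite sqr_sqrtr// sumr_ge0// => i _; rewrite sqr_ge0. Qed.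

Lemma enorm_ge0 {R : realType} {n : nat} (x : 'rV[R]_n) : 0 <= enorm x.
Proof. exact: sqrtr_ge0. Qed.

Lemma enorm0 (R : realType) (n : nat) : enorm (0 : 'rV[R]_n) = 0.
Proof.
by rewrite /enorm big1 ?sqrtr0// => i _; rewrite mxE expr0n.
Qed.

Lemma enorm_eq0 {R : realType} {n : nat} (x : 'rV[R]_n) : enorm x = 0 -> x = 0.
Proof.
move=> x0; have /eqP : \sum_(i < n) x 0 i ^+ 2 = 0.
  by rewrite -enorm_sqr x0 expr0n.
rewrite psumr_eq0; last by move=> i _; rewrite sqr_ge0.
move=> /allP h; apply/rowP => i; rewrite mxE; apply/eqP.
by rewrite -sqrf_eq0; apply: (implyP (h i _)) => //; rewrite mem_index_enum.
Qed.

Lemma enormZ {R : realType} {n : nat} (a : R) (x : 'rV[R]_n) :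
  enorm (a *: x) = `|a| * enorm x.
Proof.
rewrite /enorm -sqrtr_sqr -sqrtrM ?sqr_ge0// mulr_sumr.
by congr (Num.sqrt _); apply: eq_bigr => i _; rewrite mxE exprMn.
Qed.

Lemma enormN {R : realType} {n : nat} (x : 'rV[R]_n) : enorm (- x) = enorm x.
Proof. by rewrite -scaleN1r enormZ normrN1 mul1r. Qed.

Lemma enormB {R : realType} {n : nat} (x y : 'rV[R]_n) :
  enorm (x - y) = enorm (y - x).
Proof. by rewrite -enormN opprB. Qed.

(** Cauchy-Schwarz is obtained on the way: for nonzero vectors, the sum of the squares of
    [enorm y * x 0 i - enorm x * y 0 i] is twice |x||y|(|x||y| - s), with [s] the inner product, so
    s <= |x||y|. *)
Lemma ler_enormD {R : realType} {n : nat} (x y : 'rV[R]_n) :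
  enorm (x + y) <= enorm x + enorm y.
Proof.
have [/enorm_eq0 ->|x0] := eqVneq (enorm x) 0; first by rewrite enorm0 !add0r.
have [/enorm_eq0 ->|y0] := eqVneq (enorm y) 0; first by rewrite enorm0 !addr0.
have xy_gt0 : 0 < enorm x * enorm y.
  by rewrite mulr_gt0// lt_def ?x0 ?y0 enorm_ge0.
rewrite -ler_sqr ?nnegrE ?addr_ge0 ?enorm_ge0//.
set s := \sum_(i < n) x 0 i * y 0 i.
have -> : enorm (x + y) ^+ 2 = enorm x ^+ 2 + enorm y ^+ 2 + s *+ 2.
  rewrite !enorm_sqr /s -sumrMnl -!big_split/=; apply: eq_bigr => i _.
  by rewrite mxE; ring.
have : 0 <= \sum_(i < n) (enorm y * x 0 i - enorm x * y 0 i) ^+ 2.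
  by rewrite sumr_ge0// => i _; rewrite sqr_ge0.
have -> : \sum_(i < n) (enorm y * x 0 i - enorm x * y 0 i) ^+ 2 =
    (enorm x * enorm y) * ((enorm x * enorm y - s) *+ 2).
  transitivity (enorm y ^+ 2 * (\sum_(i < n) x 0 i ^+ 2) +
      enorm x ^+ 2 * (\sum_(i < n) y 0 i ^+ 2) - 2 * (enorm x * enorm y) * s).
    rewrite /s !mulr_sumr -big_split/= -sumrB.
    by apply: eq_bigr => i _; ring.
  by rewrite -!enorm_sqr; ring.
rewrite pmulr_rge0// => h; lra.
Qed.

(** * Derivatives of the squared distance; topology of Euclidean balls *)

Lemma is_derive_coord {R : realType} {n : nat} (x v : 'rV[R]_n) (i : 'I_n) :
  is_derive x v (fun y : 'rV[R]_n => y 0 i : R) (v 0 i).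
Proof.
apply: DeriveDef; first exact/diff_derivable/differentiable_coord.
apply: cvg_lim => //; apply: cvg_near_cst; near=> h.
rewrite /= !mxE addrK /GRing.scale/= mulKf//.
by near: h; exact: nbhs_dnbhs_neq.
Unshelve. all: by end_near. Qed.

(** Rewriting as a sum of powers of functions lets the differentiation rules for sums and powers
    apply directly. *)
Lemma enorm_sqrE {R : realType} {n : nat} (z : 'rV[R]_n) :
  (fun x => enorm (x - z) ^+ 2) =
  \sum_(i < n) ((fun x : 'rV[R]_n => x 0 i) - cst (z 0 i)) ^+ 2.
Proof.
apply/funext => x; rewrite enorm_sqr fct_sumE; apply: eq_bigr => i _.
by rewrite !mxE.
Qed.

Lemma differentiable_enorm_sqr {R : realType} {n : nat} (z x : 'rV[R]_n) :
  differentiable (fun x => enorm (x - z) ^+ 2) x.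
Proof.
rewrite enorm_sqrE; apply: differentiable_sum => i.
by apply/differentiableX/differentiableB => //; exact: differentiable_coord.
Qed.

Lemma derive_enorm_sqr {R : realType} {n : nat} (z x v : 'rV[R]_n) :
  'D_v (fun x => enorm (x - z) ^+ 2) x =
  \sum_(i < n) 2 * (x - z) 0 i * v 0 i.
Proof.
rewrite enorm_sqrE derive_sum; last first.
  move=> i; apply/derivableX/derivableB => //.
  exact/diff_derivable/differentiable_coord.
apply: eq_bigr => i _; have h := is_derive_coord x v i.
by rewrite derive_val /= !mxE expr1 subr0 /GRing.scale/=.
Qed.

Lemma enorm_sqr_continuous {R : realType} {n : nat} (z : 'rV[R]_n) :
  continuous (fun x : 'rV[R]_n => enorm (x - z) ^+ 2).
Proof.
by move=> x; exact/differentiable_continuous/differentiable_enorm_sqr.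
Qed.

Lemma enorm_continuous (R : realType) (n : nat) :
  continuous (@enorm R n).
Proof.
move=> x.
have -> : @enorm R n = (fun x => Num.sqrt (enorm (x - 0) ^+ 2)).
  by apply/funext => y; rewrite subr0 sqrtr_sqr ger0_norm// enorm_ge0.
apply: (@continuous_comp _ _ _ (fun x : 'rV[R]_n => enorm (x - 0) ^+ 2)).
  exact: enorm_sqr_continuous.
exact: sqrt_continuous.
Qed.

Lemma eball_open (R : realType) (n : nat) (r : R) : open (eball (n := n) r).
Proof.
rewrite (_ : eball r = @enorm R n @^-1` [set s | s < r])//.
by apply: open_comp; [move=> x _; exact: enorm_continuous|exact: open_lt].
Qed.

Lemma closure_eball_le {R : realType} {n : nat} (r : R) (x : 'rV[R]_n) :
  closure (eball r) x -> enorm x <= r.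
Proof.
have cl : closed [set y : 'rV[R]_n | enorm y <= r].
  rewrite (_ : [set y | _] = @enorm R n @^-1` [set s | s <= r])//.
  apply: closed_comp; last exact: closed_le.
  by move=> ? _; exact: enorm_continuous.
move=> xr; apply: (cl x).
by apply: (closure_subset _ xr) => y /= /ltW.
Qed.

Lemma norm_le_enorm {R : realType} {n : nat} (x : 'rV[R]_n) : `|x| <= enorm x.
Proof.
rewrite /Num.norm/= mx_normrE; apply: bigmax_le => [|[i j] _ /=].
  exact: enorm_ge0.
rewrite ord1 -sqrtr_sqr ler_sqrt ?sumr_ge0// => [|k _]; last by rewrite sqr_ge0.
by rewrite (bigD1 j)//= lerDl sumr_ge0// => k _; rewrite sqr_ge0.
Qed.

Lemma compact_enorm_le {R : realType} {n : nat} (z : 'rV[R]_n) (r : R) :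
  compact [set x | enorm (x - z) ^+ 2 <= r ^+ 2].
Proof.
apply: bounded_closed_compact; last first.
  rewrite (_ : [set y | _] =
      (fun x => enorm (x - z) ^+ 2) @^-1` [set s | s <= r ^+ 2])//.
  apply: closed_comp; last exact: closed_le.
  by move=> ? _; exact: enorm_sqr_continuous.
exists (`|r| + enorm z); split; first exact: num_real.
move=> M /ltW rM x /= xr; apply: le_trans rM.
apply: le_trans (norm_le_enorm _) _.
rewrite -[x in enorm x](subrK z); apply: le_trans (ler_enormD _ _) _.
by rewrite lerD2r -ler_sqr ?nnegrE ?enorm_ge0// real_normK// num_real.
Qed.

Lemma compact_closure_eball (R : realType) (n : nat) (r : R) :
  compact (closure (eball (n := n) r)).
Proof.
apply: (subclosed_compact _ (compact_enorm_le 0 r)).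
  exact: closed_closure.
move=> x /closure_eball_le xr /=; rewrite subr0.
by rewrite ler_sqr ?nnegrE ?enorm_ge0// (le_trans (enorm_ge0 x)).
Qed.

(** * Quadratic test functions *)

Definition quad {R : realType} {n : nat} (a c : R) (z x : 'rV[R]_n) : R :=
  a * enorm x ^+ 2 + c * enorm (x - z) ^+ 2.

Lemma quadE {R : realType} {n : nat} (a c : R) (z : 'rV[R]_n) :
  quad a c z = a *: (fun x => enorm (x - 0) ^+ 2) +
               c *: (fun x => enorm (x - z) ^+ 2).
Proof. by apply/funext => x; rewrite /quad -{1}(subr0 x). Qed.

Lemma differentiable_quad {R : realType} {n : nat} (a c : R) (z x : 'rV[R]_n) :
  differentiable (quad a c z) x.
Proof.
rewrite quadE; apply: differentiableD;
  exact/differentiableZ/differentiable_enorm_sqr.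
Qed.

Lemma grad_quad {R : realType} {n : nat} (a c : R) (z x : 'rV[R]_n) :
  grad (quad a c z) x = (2 * a) *: x + (2 * c) *: (x - z).
Proof.
have d w v : derivable (fun x => enorm (x - w) ^+ 2) x v.
  exact/diff_derivable/differentiable_enorm_sqr.
have e w i : 'D_('e_i) (fun x => enorm (x - w) ^+ 2) x = 2 * (x - w) 0 i.
  rewrite derive_enorm_sqr (bigD1 i)//= big1 ?addr0 => [|j ji];
    rewrite [X in _ * X]mxE.
    by rewrite !eqxx mulr1.
  by rewrite (negbTE ji) andbF mulr0.
apply/rowP => i; rewrite mxE quadE deriveD; [|exact: derivableZ..].
rewrite (deriveZ _ (d 0 _)) (deriveZ _ (d z _)) !e subr0 !mxE /GRing.scale/=.
by ring.
Qed.

Lemma C1_quad {R : realType} {n : nat} (a c : R) (z : 'rV[R]_n) U :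
  C1_open U (quad a c z).
Proof.
move=> x _; split; first exact: differentiable_quad.
have -> : grad (quad a c z) = fun x => (2 * a) *: x + (2 * c) *: (x - z).
  by apply/funext => y; rewrite grad_quad.
apply: differentiable_continuous; apply: differentiableD.
  exact/differentiableZ.
exact/differentiableZ/differentiableB.
Qed.

(** * Continuity and bounds for BUC functions, tests by quadratics, a priori bounds *)

Lemma BUC_continuous {R : realType} {n : nat} {A : set 'rV[R]_n}
  {v : 'rV[R]_n -> R} : BUC A v -> {within A, continuous v}.
Proof.
move=> [_ ucv] x; apply/cvg_entourageP => E entE.
have := nbhs_entourage x (ucv _ entE).
by apply: filterS => y; rewrite /xsection/= inE.
Qed.

Lemma BUC_bounded {R : realType} {n : nat} {A : set 'rV[R]_n}
  {v : 'rV[R]_n -> R} :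
  BUC A v -> exists2 B, 0 <= B & forall x, A x -> `|v x| <= B.
Proof.
move=> [[M [_ vM]] _]; exists (Num.max 0 (M + 1)) => [|x Ax].
  by rewrite le_max lexx.
by apply: vM => //; rewrite lt_max ltrDl ltr01 orbT.
Qed.

Lemma subsolution_quad {R : realType} {n : nat}
  {H : 'rV[R]_n -> 'rV[R]_n -> R} {Omega v} (a c : R) (z x : 'rV[R]_n) :
  viscosity_subsolution H Omega v -> Omega x ->
  (\forall y \near x, Omega y ->
    v y - quad a c z y <= v x - quad a c z x) ->
  v x + H x ((2 * a) *: x + (2 * c) *: (x - z)) <= 0.
Proof.
move=> [_ sub] Ox loc; rewrite -grad_quad; apply: sub => //.
exact: C1_quad.
Qed.

Lemma supersolution_quad {R : realType} {n : nat}
  {H : 'rV[R]_n -> 'rV[R]_n -> R} {Omega v} (a c : R) (z x : 'rV[R]_n) :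
  viscosity_supersolution_closure H Omega v -> closure Omega x ->
  (\forall y \near x, closure Omega y ->
    v x - quad a c z x <= v y - quad a c z y) ->
  0 <= v x + H x ((2 * a) *: x + (2 * c) *: (x - z)).
Proof.
move=> [_ super] Ox loc; rewrite -grad_quad; apply: super => //.
by exists setT; split => //; [exact: openT|exact: C1_quad].
Qed.

Lemma quad_continuous {R : realType} {n : nat} (a c : R) (z : 'rV[R]_n) :
  continuous (quad a c z).
Proof. by move=> x; exact/differentiable_continuous/differentiable_quad. Qed.

(* Near any point, penalizing by a large quadratic produces a point where the
   subsolution inequality can be tested. *)
Lemma subsolution_le {R : realType} {n : nat}
  {H : 'rV[R]_n -> 'rV[R]_n -> R} {Omega v} (C : R) :
  open Omega -> (forall x p, - C <= H x p) ->
  viscosity_subsolution H Omega v -> forall x, Omega x -> v x <= C.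
Proof.
move=> oO HC sub x Ox; have [B B0 vB] := BUC_bounded sub.1.
have /nbhs_ballP[d /= d0 dO] := open_nbhs_nbhs (conj oO Ox).
pose K := [set y : 'rV[R]_n | enorm (y - x) ^+ 2 <= (d / 2) ^+ 2].
have KO : K `<=` Omega.
  move=> y; rewrite /K/= ler_sqr ?nnegrE ?enorm_ge0 ?divr_ge0 ?(ltW d0)// => yd.
  apply: dO; rewrite -ball_normE/= distrC.
  apply: le_lt_trans (norm_le_enorm _) _; apply: le_lt_trans yd _.
  by rewrite ltr_pdivrMr// ltr_pMr// ltr1n.
have Kx : K x by rewrite /K/= subrr enorm0 expr0n/= sqr_ge0.
(* On the sphere of radius d/2 the penalty is 2B + 1, more than the oscillation 2B of [v], so the
   maximum over [K] is attained strictly inside. *)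
pose c := (2 * B + 1) / (d / 2) ^+ 2.
have d20 : 0 < (d / 2) ^+ 2 by rewrite exprn_gt0// divr_gt0.
have c0 : 0 < c by rewrite divr_gt0// ltr_wpDl// mulr_ge0.
have cd : c * (d / 2) ^+ 2 = 2 * B + 1 by rewrite /c mulfVK// gt_eqF.
have [] := @compact_EVT_max _ _ (v \- quad 0 c x) K _ (compact_enorm_le _ _) _.
- by exists x.
- apply: within_continuousB.
    by apply: continuous_subspaceW KO _; exact: BUC_continuous sub.1.
  by apply: continuous_subspaceT; exact: quad_continuous.
move=> y; rewrite inE => Ky ymax.
have := ymax x; rewrite inE => /(_ Kx).
rewrite /= /quad !mul0r !add0r subrr enorm0 expr0n mulr0 subr0 => vxy.
have yd : enorm (y - x) ^+ 2 < (d / 2) ^+ 2.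
  rewrite -(ltr_pM2l c0) cd.
  have := vB _ Ox; have := vB _ (KO _ Ky); rewrite !ler_norml.
  by move=> /andP[? ?] /andP[? ?]; lra.
have : v y + H y ((2 * 0) *: y + (2 * c) *: (y - x)) <= 0.
  apply: (subsolution_quad _ _ _ _ sub); first exact: KO.
  have /= : \forall w \near y, enorm (w - x) ^+ 2 < (d / 2) ^+ 2.
    apply: (enorm_sqr_continuous x y [set s | s < (d / 2) ^+ 2]).
    by apply: open_nbhs_nbhs; split => //; exact: open_lt.
  apply: filterS => w wd _; apply: ymax; rewrite inE.
  exact: ltW.
have := HC y ((2 * 0) *: y + (2 * c) *: (y - x)).
have : 0 <= c * enorm (y - x) ^+ 2 by rewrite mulr_ge0 ?sqr_ge0 ?ltW.
lra.
Qed.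

(* Tilting by d |y|^2 makes the infimum attained even if Omega is unbounded;
   the momentum 2 d y at the minimum point vanishes with d. *)
Lemma supersolution_ge {R : realType} {n : nat}
  {H : 'rV[R]_n -> 'rV[R]_n -> R} {Omega v} (C eta : R) :
  0 < eta <= 1 -> (forall x p, enorm p <= eta -> H x p <= C) ->
  viscosity_supersolution_closure H Omega v ->
  forall x, closure Omega x -> - (C + 1) <= v x.
Proof.
move=> /andP[eta0 eta1] HC super x Ox.
have [B B0 vB] := BUC_bounded super.1.
have vB2 y z : closure Omega y -> closure Omega z -> v y - v z <= 2 * B.
  move=> /vB + /vB; rewrite !ler_norml => /andP[_ ?] /andP[? _]; lra.
pose s := enorm x ^+ 2; have s0 : 0 <= s by rewrite sqr_ge0.
(* At the minimum point, d |y|^2 <= 2B + d s. The choice d t = eta^2 then gives |2 d y|^2 <= 4 d (2B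
   + s) <= eta^2, and also d s <= 1. *)
pose t := 4 * (2 * B + s) + 1; have t1 : 1 <= t by rewrite lerDr; lra.
have t0 : 0 < t by lra.
pose d := eta ^+ 2 / t; have d0 : 0 < d by rewrite divr_gt0// exprn_gt0.
have dt : d * t = eta ^+ 2 by rewrite /d mulfVK// gt_eqF.
have eta21 : eta ^+ 2 <= 1 by rewrite exprn_ile1// ltW.
have d1 : d <= 1 by rewrite ler_pdivrMr// mul1r (le_trans eta21).
(* Here d r^2 = 2B + 1 + d s exceeds the bound on d |y|^2, so the minimum point lies strictly inside
   the ball of radius [r] and the truncation to [K] is harmless. *)
pose r := Num.sqrt ((2 * B + 1) / d + s).
have r2 : r ^+ 2 = (2 * B + 1) / d + s.
  by rewrite sqr_sqrtr// addr_ge0// divr_ge0 ?ltW//; lra.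
have dr2 : d * r ^+ 2 = 2 * B + 1 + d * s.
  by rewrite r2 mulrDr [d * (_ / _)]mulrC mulfVK// gt_eqF.
pose K := closure Omega `&` [set y : 'rV[R]_n | enorm (y - 0) ^+ 2 <= r ^+ 2].
have Kx : K x.
  split => //=; rewrite subr0 -/s r2 lerDr divr_ge0 ?ltW//; lra.
have [] := @compact_EVT_min _ _ (v \- quad (- d) 0 0) K _ _ _.
- by exists x.
- apply: (subclosed_compact _ (compact_enorm_le 0 r)); last by move=> y [].
  apply: closedI; first exact: closed_closure.
  exact: compact_closed (compact_enorm_le 0 r).
- apply: within_continuousB.
    apply: continuous_subspaceW (BUC_continuous super.1).
    by move=> y [].
  by apply: continuous_subspaceT; exact: quad_continuous.
move=> y; rewrite inE => Ky ymin.
have [Oy _] := Ky.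
have := ymin x; rewrite inE => /(_ Kx).
rewrite /= /quad !mul0r !addr0 -/s => vyx.
have dy : d * enorm y ^+ 2 <= 2 * B + d * s.
  by have := vB2 _ _ Ox Oy; lra.
have : 0 <= v y + H y ((2 * - d) *: y + (2 * 0) *: (y - 0)).
  apply: (supersolution_quad _ _ _ _ super) => //.
  have /= : \forall w \near y, enorm (w - 0) ^+ 2 < r ^+ 2.
    apply: (enorm_sqr_continuous 0 y [set s | s < r ^+ 2]).
    apply: open_nbhs_nbhs; split => /=; first exact: open_lt.
    by rewrite -(ltr_pM2l d0) dr2 subr0; lra.
  apply: filterS => w wd Ow; apply: ymin; rewrite inE.
  by split => //; exact: ltW.
have := HC y ((2 * - d) *: y + (2 * 0) *: (y - 0)).
rewrite mulr0 scale0r addr0.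
have -> : enorm ((2 * - d) *: y) <= eta.
  rewrite -ler_sqr ?nnegrE ?enorm_ge0 ?(ltW eta0)//.
  rewrite enormZ exprMn real_normK ?num_real//.
  rewrite (_ : (2 * - d) ^+ 2 * _ = 4 * d * (d * enorm y ^+ 2)); last by ring.
  rewrite -dt (_ : d * t = 4 * d * (2 * B + s) + d); last by rewrite /t; ring.
  have d40 : 0 <= 4 * d by rewrite mulr_ge0// ltW.
  have dss : d * s <= s by rewrite ler_piMl.
  apply: (@le_trans _ _ (4 * d * (2 * B + s))); last by rewrite lerDl ltW.
  by apply: ler_wpM2l => //; lra.
move=> /(_ isT) Hy vHy.
(* Comparing the minimum with the value at [x] gives v x + d s >= v y >= -C; the term d s is the
   extra 1 in the bound. *)
have : d * s <= 1.
  apply: le_trans eta21; rewrite -dt ler_pM2l// /t; lra.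
have : 0 <= d * enorm y ^+ 2 by rewrite mulr_ge0 ?sqr_ge0 ?ltW.
lra.
Qed.

(** * Doubling of variables *)

Lemma doubling_max {R : realType} {n : nat} {w v : 'rV[R]_n -> R}
  {K1 K2 : set 'rV[R]_n} (a c : R) :
  compact K1 -> compact K2 -> K1 !=set0 -> K2 !=set0 ->
  {within K1, continuous w} -> {within K2, continuous v} ->
  exists x0 y0, [/\ K1 x0, K2 y0 & forall x y, K1 x -> K2 y ->
    w x - v y - quad a c y x <= w x0 - v y0 - quad a c y0 x0].
Proof.
move=> cK1 cK2 [x1 Kx1] [y1 Ky1].
move=> /subspace_continuousP cw /subspace_continuousP cv.
pose f (p : 'rV[R]_n * 'rV[R]_n) := w p.1 - v p.2 - quad a c p.2 p.1.
have cq : continuous (fun p : 'rV[R]_n * 'rV[R]_n => quad a c p.2 p.1).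
  move=> p; have pF := nbhs_filter p.
  have p1 := @cvg_fst _ _ (nbhs p.1) (nbhs p.2) (nbhs_filter p.2).
  have p2 := @cvg_snd _ _ (nbhs p.1) (nbhs p.2) (nbhs_filter p.1).
  have c1 : enorm q.1 @[q --> p] --> enorm p.1.
    by apply: cvg_comp p1 _; exact: enorm_continuous.
  have cB : q.1 - q.2 @[q --> p] --> p.1 - p.2 by exact: (@cvgB _ _ _ _ pF).
  have c2 : enorm (q.1 - q.2) @[q --> p] --> enorm (p.1 - p.2).
    by apply: cvg_comp cB _; exact: enorm_continuous.
  rewrite /continuous_at /quad.
  by apply: cvgD; (apply: cvgM; first exact: cvg_cst); exact: cvgM.
have cf : {within K1 `*` K2, continuous f}.
  apply: within_continuousB; last exact: continuous_subspaceT.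
  apply: within_continuousB; apply/subspace_continuousP => -[x y] [/= Kx Ky].
    apply: (@cvg_comp _ _ _ fst w _ (within K1 (nbhs x))); last exact: cw.
    move=> P KP; have := @cvg_fst _ _ (nbhs x) (nbhs y) (nbhs_filter y) _ KP.
    by apply: (@filterS _ _ (nbhs_filter (x, y))) => -[x' y'] /= {}KP [/KP].
  apply: (@cvg_comp _ _ _ snd v _ (within K2 (nbhs y))); last exact: cv.
  move=> P KP; have := @cvg_snd _ _ (nbhs x) (nbhs y) (nbhs_filter x) _ KP.
  by apply: (@filterS _ _ (nbhs_filter (x, y))) => -[x' y'] /= {}KP [_ /KP].
have [] := compact_EVT_max _ (compact_setX cK1 cK2) cf.
  by exists (x1, y1).
move=> [x0 y0]; rewrite inE => -[/= K1x0 K2y0] fmax.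
exists x0, y0; split => // x y Kx Ky.
by apply: (fmax (x, y)); rewrite inE.
Qed.

(** Common core of both inequalities. Here [r] bounds the momentum of the subsolution through
    coercivity, [b] bounds the gradient 2 a x of the penalty, so both momenta stay within r + b,
    where [L] is a Lipschitz constant. The hypothesis before the conclusion says that a close pair
    with positive penalized gap never feels the truncation to [K1] and [K2]. *)
Lemma doubling_comparison {R : realType} {n : nat}
  {H : 'rV[R]_n -> 'rV[R]_n -> R} {Omega1 Omega2 K1 K2 : set 'rV[R]_n}
  {w v : 'rV[R]_n -> R} (a b m M r L : R) :
  0 <= a -> 0 <= L ->
  (forall x p, r < enorm p -> m < H x p) ->
  (forall x y p q, enorm p <= r + b -> enorm q <= r + b ->
     `|H x p - H y p| <= L * enorm (x - y) /\
     `|H x p - H x q| <= L * enorm (p - q)) ->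
  viscosity_subsolution H Omega1 w ->
  viscosity_supersolution_closure H Omega2 v ->
  compact K1 -> compact K2 -> K2 `<=` closure Omega2 ->
  {within K1, continuous w} ->
  (forall x, K1 x -> - m <= w x /\ 2 * a * enorm x <= b) ->
  (forall x y, K1 x -> K2 y -> w x - v y <= M) ->
  (forall x y, K1 x -> K2 y -> enorm (x - y) <= 1 / 2 ->
     0 < w x - v y - a * enorm x ^+ 2 ->
     [/\ Omega1 x, \forall x' \near x, Omega1 x' -> K1 x' &
       \forall y' \near y, closure Omega2 y' -> K2 y']) ->
  forall x, K1 x -> K2 x -> w x - v x - a * enorm x ^+ 2 <= a * L ^+ 2.
Proof.
move=> a0 L0 coer lip sub super cK1 cK2 K2O cw K1b wvM int x K1x K2x.
have aL0 : 0 <= a * L ^+ 2 by rewrite mulr_ge0// sqr_ge0.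
have [|s0] := leP (w x - v x - a * enorm x ^+ 2) 0; first lra.
have cv : {within K2, continuous v}.
  exact: continuous_subspaceW K2O (BUC_continuous super.1).
have M0 : 0 <= M.
  apply: le_trans (wvM _ _ K1x K2x).
  have : 0 <= a * enorm x ^+ 2 by rewrite mulr_ge0// sqr_ge0.
  lra.
apply/ler_addgt0Pr => e e0.
(* The summand 4M + 1 forces |x0 - y0| <= 1/2, and the last one makes L |x0 - y0| <= e once the
   momentum is bounded. *)
pose c := 4 * M + 1 + `|L * (r + b)| / e.
have ce : L * (r + b) <= c * e.
  have -> : c * e = (4 * M + 1) * e + `|L * (r + b)|.
    by rewrite /c mulrDl mulfVK// gt_eqF.
  apply: le_trans (ler_norm _) _; rewrite lerDr mulr_ge0 ?(ltW e0)//; lra.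
have cM : 4 * M + 1 <= c by rewrite lerDl divr_ge0// ltW.
have c0 : 0 < c by lra.
have [x0 [y0 [K1x0 K2y0 wvmax]]] :=
  doubling_max a c cK1 cK2 (ex_intro _ x K1x) (ex_intro _ x K2x) cw cv.
have := wvmax _ _ K1x K2x.
rewrite {1}/quad subrr enorm0 expr0n mulr0 addr0 => le0.
have d0 := enorm_ge0 (x0 - y0); have x00 := enorm_ge0 x0.
have cd0 : 0 <= c * enorm (x0 - y0) ^+ 2 by rewrite mulr_ge0 ?sqr_ge0 ?ltW.
have ax0 : 0 <= a * enorm x0 ^+ 2 by rewrite mulr_ge0 ?sqr_ge0.
have dM : c * enorm (x0 - y0) ^+ 2 <= M.
  by have := wvM _ _ K1x0 K2y0; move: le0; rewrite /quad; lra.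
have dh : enorm (x0 - y0) <= 1 / 2.
  rewrite leNgt; apply/negP => dh.
  have : (1 / 2) ^+ 2 <= enorm (x0 - y0) ^+ 2.
    by rewrite ler_sqr ?nnegrE//; lra.
  by move=> h; have := ler_wpM2l (ltW c0) h; lra.
have pos0 : 0 < w x0 - v y0 - a * enorm x0 ^+ 2.
  by move: le0; rewrite /quad; lra.
have [Ox0 nx0 ny0] := int _ _ K1x0 K2y0 dh pos0.
pose q := (2 * c) *: (x0 - y0); pose p := (2 * a) *: x0 + q.
have subp : w x0 + H x0 p <= 0.
  apply: (subsolution_quad _ _ _ _ sub) => //.
  apply: filterS nx0 => z Oz /Oz Kz.
  by have := wvmax _ _ Kz K2y0; lra.
have superq : 0 <= v y0 + H y0 q.
  (* In the second variable the test function is -c |y - x0|^2, with no [a] term; its gradient at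
     [y0] is [q], so [p] and [q] differ only by 2 a x0. *)
  have -> : q = (2 * 0) *: y0 + (2 * - c) *: (y0 - x0).
    by rewrite mulr0 scale0r add0r mulrN scaleNr -scalerN opprB.
  apply: (supersolution_quad _ _ _ _ super); first exact: K2O.
  apply: filterS ny0 => z Oz /Oz Kz.
  have := wvmax _ _ K1x0 Kz.
  by rewrite /quad (enormB x0 z) (enormB x0 y0); lra.
have [mw ab] := K1b _ K1x0.
have axb : enorm ((2 * a) *: x0) <= b by rewrite enormZ ger0_norm ?mulr_ge0.
have b0 : 0 <= b := le_trans (enorm_ge0 _) axb.
(* Otherwise H x0 p > m, which with w x0 >= -m contradicts the subsolution inequality. *)
have pr : enorm p <= r.
  by rewrite leNgt; apply/negP => /(coer x0); lra.
have qr : enorm q <= r + b.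
  have -> : q = p + - ((2 * a) *: x0) by rewrite /p addrC addKr.
  by apply: le_trans (ler_enormD _ _) _; rewrite enormN; lra.
have prb : enorm p <= r + b by lra.
have [] := lip y0 x0 q p qr prb; rewrite ler_norml => /andP[_ Hy] _.
have [_] := lip x0 x0 q p qr prb; rewrite ler_norml => /andP[_ Hq].
have pq : enorm (q - p) = 2 * a * enorm x0.
  by rewrite enormB /p addrK enormZ ger0_norm// mulr_ge0.
have Ld : L * enorm (x0 - y0) <= e.
  rewrite -(ler_pM2l c0); apply: le_trans ce.
  have : enorm q = 2 * c * enorm (x0 - y0).
    by rewrite enormZ ger0_norm// mulr_ge0// ltW.
  have cd : 0 <= c * enorm (x0 - y0) by rewrite mulr_ge0// ltW.
  rewrite mulrCA => qE; apply: ler_wpM2l => //; lra.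
(* The two viscosity inequalities give w x0 - v y0 <= H y0 q - H x0 p <= e + 2 a L |x0|; completing
   the square absorbs the last term into a |x0|^2 + a L^2. *)
have sq : 0 <= a * (L - enorm x0) ^+ 2 by rewrite mulr_ge0// sqr_ge0.
have sqE : a * (L - enorm x0) ^+ 2 =
  a * L ^+ 2 - L * (2 * a * enorm x0) + a * enorm x0 ^+ 2 by ring.
move: le0 Hy Hq; rewrite /quad pq (enormB y0 x0); lra.
Qed.

(** * Extension to the boundary and proof of the theorem *)

(** Carries the upper bound on [u_ k], available only in the open ball where it is a subsolution, up
    to the sphere. *)
Lemma within_closure_le {R : realType} {T : topologicalType} {A : set T}
  {v : T -> R} (C : R) :
  {within closure A, continuous v} -> (forall x, A x -> v x <= C) ->
  forall x, closure A x -> v x <= C.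
Proof.
move=> /subspace_continuousP cv vC x Ax; rewrite leNgt; apply/negP => Cv.
have : \forall y \near within (closure A) (nbhs x), C < v y.
  apply: (cv x Ax [set s | C < s]).
  by apply: open_nbhs_nbhs; split => //; exact: open_gt.
move=> /Ax[y [Ay /(_ (subset_closure Ay)) /=]].
by rewrite ltNge vC.
Qed.

Theorem theorem1p1 (R : realType) (n : nat) (n_gt0 : (0 < n)%N)
    (H : 'rV[R]_n -> 'rV[R]_n -> R)
    (H_cont : continuous (fun z : 'rV[R]_n * 'rV[R]_n => H z.1 z.2))
    (H1 : exists2 C1 : R, 0 < C1 & forall x p, - C1 <= H x p)
    (H2 : exists2 C2 : R, 0 < C2 &
       (ereal_sup [set `|H x 0|%:E | x in [set: 'rV[R]_n]] <= C2%:E)%E)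
    (H3 : forall r : R, 0 < r -> exists Cr : R,
       forall x y p q, enorm p <= r -> enorm q <= r ->
         `|H x p - H y p| <= Cr * enorm (x - y) /\
         `|H x p - H x q| <= Cr * enorm (p - q))
    (H4 : forall M : R, exists r : R, forall p : 'rV[R]_n, r < enorm p ->
       (M%:E <= ereal_inf [set (H x p)%:E | x in [set: 'rV[R]_n]])%E) :
  exists2 C : R, 0 < C &
    forall (u_ : nat -> 'rV[R]_n -> R) (u : 'rV[R]_n -> R),
      (forall k : nat, (0 < k)%N ->
         state_constraint_solution H (eball (n := n) k%:R) (u_ k)) ->
      state_constraint_solution H setT u ->
      [/\ forall (k : nat) (x : 'rV[R]_n), (0 < k)%N ->
            closure (eball k%:R) x -> u x <= u_ k x,
          forall (k : nat) (x : 'rV[R]_n), (0 < k)%N ->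
            closure (eball k%:R) x ->
            0 <= u_ k x - u x <= C * (1 + enorm x ^+ 2) / k%:R ^+ 2
        & forall r : R, 0 < r ->
            forall (k : nat) (x : 'rV[R]_n), (0 < k)%N ->
            closure (eball k%:R) x -> enorm x <= r ->
            0 <= u_ k x - u x <= C * (1 + r ^+ 2) / k%:R ^+ 2].

Proof.
have [C1 C10 HC1] := H1; have [C2 C20 HC2] := H2.
have HC2x x : H x 0 <= C2.
  rewrite (le_trans (ler_norm _))// -lee_fin; apply: le_trans HC2.
  by apply: ereal_sup_ubound; exists x.
have lipge0 r : 0 < r -> exists2 L, 0 <= L & forall x y p q,
    enorm p <= r -> enorm q <= r -> `|H x p - H y p| <= L * enorm (x - y) /\
      `|H x p - H x q| <= L * enorm (p - q).
  move=> /H3[L HL]; exists (Num.max L 0) => [|x y p q pr qr].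
    by rewrite le_max lexx orbT.
  have [h1 h2] := HL x y p q pr qr.
  by split; [apply: le_trans h1 _|apply: le_trans h2 _];
    rewrite ler_wpM2r ?enorm_ge0// le_max lexx.
have [eta eta01 Heta] : exists2 eta, 0 < eta <= 1 &
    forall x p, enorm p <= eta -> H x p <= C2 + 1.
  have [L L0 HL] := lipge0 1 ltr01.
  (* For |p| <= 1/(L + 1) the local Lipschitz bound gives H x p <= H x 0 + L |p| <= C2 + 1. *)
  exists (L + 1)^-1; first by rewrite invr_gt0 invf_le1; lra.
  move=> x p pe.
  have p1 : enorm p <= 1 by rewrite (le_trans pe)// invf_le1; lra.
  have [|_] := HL x x p 0 p1; first by rewrite enorm0.
  rewrite subr0 ler_norml => /andP[_ h].
  suff : L * enorm p <= 1 by have := HC2x x; lra.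
  have : (L + 1) * enorm p <= 1 by rewrite mulrC -ler_pdivlMr ?div1r//; lra.
  by have := enorm_ge0 p; lra.
(* All solutions take values between -m and C1, so [M] bounds u_k - u. One 1 in [m] comes from the
   choice of [eta], the other from [supersolution_ge]. *)
pose m := C2 + 1 + 1; pose M := C1 + m.
have M0 : 0 < M by rewrite /M /m; lra.
have [r r0 coer] : exists2 r, 0 <= r &
    forall x p, r < enorm p -> m < H x p.
  have [r Hr] := H4 (m + 1); exists (Num.max r 0) => [|x p].
    by rewrite le_max lexx orbT.
  rewrite gt_max => /andP[/Hr rp _].
  have : m + 1 <= H x p.
    rewrite -lee_fin; apply: le_trans rp _.
    by apply: ereal_inf_lbound; exists x.
  lra.
(* With a = M/k^2, |x| <= k and k >= 1, the penalty gradient 2 a |x| is at most 2M. *)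
have rM0 : 0 < r + 2 * M by lra.
have [L L0 lip] := lipge0 _ rM0.
have ML0 : 0 <= M * L ^+ 2 by rewrite mulr_ge0 ?sqr_ge0// ltW.
(* The constant is fixed before the solutions are introduced, hence depends only on [H]. *)
exists (M + M * L ^+ 2); first lra.
move=> u_ u solk sol.
have um x : - m <= u x.
  apply: (supersolution_ge (C2 + 1) eta eta01 Heta sol.2).
  by rewrite closureT.
have uM x : u x <= C1 by exact: (subsolution_le C1 openT HC1 sol.1).
have cu K : {within K, continuous u}.
  by apply: continuous_subspaceW (BUC_continuous sol.1.1) => x _.
have ukc k : (0 < k)%N ->
    {within closure (eball (n := n) k%:R), continuous (u_ k)}.
  by move=> /solk[_ [+ _]] => /BUC_continuous.
have ukm k x : (0 < k)%N -> closure (eball k%:R) x -> - m <= u_ k x.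
  by move=> /solk[_ s]; exact: (supersolution_ge (C2 + 1) eta eta01 Heta s).
have ukM k x : (0 < k)%N -> closure (eball k%:R) x -> u_ k x <= C1.
  move=> k0; apply: within_closure_le; first exact: ukc.
  exact: (subsolution_le C1 (eball_open _ _ _) HC1 (solk k k0).1).
have eball_near (k : R) (x : 'rV[R]_n) : enorm x < k ->
    \forall y \near x, closure (eball k) y.
  move=> xk; apply: filterS (@subset_closure _ _) _.
  by apply: open_nbhs_nbhs; split; [exact: eball_open|].
have le_eball (k : nat) : closure (eball (n := n) k%:R) `<=`
    closure (eball (n := n) (k%:R + 1)).
  by apply: closure_subset => x /= /lt_le_trans; apply; rewrite lerDl.
have u_le k x : (0 < k)%N -> closure (eball k%:R) x -> u x <= u_ k x.
  move=> k0 kx.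
  suff : u x - u_ k x - 0 * enorm x ^+ 2 <= 0 * L ^+ 2.
    by rewrite !mul0r subr0 subr_le0.
  (* The variable of [u] ranges over the ball of radius k + 1: being within 1/2 of a point of the
     closed ball of radius k, it is interior. The other variable fills the whole closed domain of
     [u_ k], so its truncation is vacuous. *)
  apply: (@doubling_comparison R n H setT (eball k%:R)
    (closure (eball (k%:R + 1))) (closure (eball k%:R)) u (u_ k)
    0 (2 * M) m M r L (lexx 0) L0 coer lip sol.1 (solk k k0).2) => //.
  - exact: compact_closure_eball.
  - exact: compact_closure_eball.
  - by move=> y _; split; [exact: um|rewrite mulr0 mul0r; lra].
  - by move=> y z _ kz; have := ukm k z k0 kz; have := uM y; rewrite /M; lra.
  - move=> y z _ /closure_eball_le zk yz _; split => //; last by apply: filterE.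
    have yk : enorm y < k%:R + 1.
      by have := ler_enormD (y - z) z; rewrite subrK; lra.
    by apply: filterS (eball_near _ _ yk).
  - exact: le_eball.
have u_ge k x : (0 < k)%N -> closure (eball k%:R) x ->
    u_ k x - u x <= (M + M * L ^+ 2) * (1 + enorm x ^+ 2) / k%:R ^+ 2.
  move=> k0 kx.
  have k1 : 1 <= k%:R :> R by rewrite ler1n.
  have k20 : 0 < k%:R ^+ 2 :> R by rewrite exprn_gt0//; lra.
  pose a := M / k%:R ^+ 2; have a0 : 0 <= a by rewrite divr_ge0 ?ltW.
  have ak y : enorm y <= k%:R -> 2 * a * enorm y <= 2 * M.
    move=> yk; rewrite -mulrA ler_pM2l// /a mulrAC ler_pdivrMr//.
    rewrite ler_pM2l//; apply: le_trans yk _.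
    by rewrite expr2 ler_peMl//; lra.
  (* The comparison yields a L^2 + a |x|^2; the remaining terms of the right-hand side are
     nonnegative. *)
  have -> : (M + M * L ^+ 2) * (1 + enorm x ^+ 2) / k%:R ^+ 2 =
      a * L ^+ 2 * (1 + enorm x ^+ 2) + a * enorm x ^+ 2 + a.
    by rewrite /a; ring.
  have aLx : 0 <= a * L ^+ 2 * enorm x ^+ 2.
    by rewrite mulr_ge0 ?sqr_ge0 ?(mulr_ge0 a0) ?sqr_ge0.
  suff : u_ k x - u x - a * enorm x ^+ 2 <= a * L ^+ 2 by lra.
  apply: (@doubling_comparison R n H (eball k%:R) setT
    (closure (eball k%:R)) (closure (eball (k%:R + 1))) (u_ k) u
    a (2 * M) m M r L a0 L0 coer lip (solk k k0).1 sol.2) => //.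
  - exact: compact_closure_eball.
  - exact: compact_closure_eball.
  - by rewrite closureT.
  - exact: ukc.
  - by move=> y ky; split; [exact: ukm|exact/ak/closure_eball_le].
  - by move=> y z ky _; have := ukM k y k0 ky; have := um z; rewrite /M; lra.
  - move=> y z ky _ yz pos.
    (* If |y| >= k then a |y|^2 >= M, which is at least u_k y - u z, contradicting positivity. *)
    have yk : enorm y < k%:R.
      rewrite ltNge; apply/negP => yk.
      have : M <= a * enorm y ^+ 2.
        rewrite /a mulrAC ler_pdivlMr// ler_pM2l//.
        by rewrite ler_sqr ?nnegrE ?enorm_ge0//; lra.
      by have := ukM k y k0 ky; have := um z; move: pos; rewrite /M; lra.
    split => //; first by apply: filterS (eball_near _ _ yk).
    have zk : enorm z < k%:R + 1.
      by have := ler_enormD (z - y) y; rewrite subrK (enormB z y); lra.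
    by apply: filterS (eball_near _ _ zk).
  - exact: le_eball.
split => //.
- move=> k x k0 kx; rewrite u_ge// andbT subr_ge0; exact: u_le.
- move=> s s0 k x k0 kx xs; rewrite subr_ge0 u_le//=.
  apply: le_trans (u_ge k x k0 kx) _.
  rewrite ler_wpM2r ?invr_ge0 ?sqr_ge0// ler_wpM2l ?lerD2l//; first lra.
  by rewrite ler_sqr ?nnegrE ?enorm_ge0// ltW.
Qed.
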